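(* For all integers $w\geq0$, $k\geq1$ and $p\geq p_{w,k}$, the graph $G^{k}_{w,p}$ contains every graph with at most $\gamma(w,p)$ vertices and treewidth at most $k$.
   Context: For integers $w,p\geq0$ and $k\geq1$ define $\alpha(w,p)=\frac{1}{1+(2/3)^{w}}\Big(\frac{2+(2/3)^{w}}{1+(2/3)^{w}}\Big)^{p-1}$, $\gamma(w,p)=\Big(\frac{2+(2/3)^{w}}{1+(2/3)^{w}}\Big)^{p}$, $\beta_k(w)=(2k+4)(\frac{3}{2})^{w}$ and $\delta_k(w)=(2+(\frac{2}{3})^{w})\beta_k(w)$. Let $p_{w,k}$ be the smallest integer such that $\alpha(w,p_{w,k}+1)\geq\beta_k(w)$. For $p\geq p_{w,k}$ define $G^{k}_{w,p}$ recursively: $G^{k}_{w,p_{w,k}}$ is the complete graph $K_{\lceil\delta_k(w)\rceil}$, and for $p\geq p_{w,k}+1$, $G^{k}_{w,p}$ is obtained from a complete graph $K_{(k+1)(w+1)}$ and two disjoint copies of $G^{k}_{w,p-1}$ by adding all edges between the vertices of $K_{(k+1)(w+1)}$ and the vertices of the two copies. A graph $U$ contains a graph $H$ if some subgraph of $U$ is isomorphic to $H$. Treewidth is the usual notion. *)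

(* Defs.v *)
From HB Require Import structures.
From mathcomp Require Import all_boot all_order all_algebra.
From mathcomp Require Import archimedean boolp.
From mathcomp Require Import ring lra zify.

Set Implicit Arguments.
Unset Strict Implicit.
Unset Printing Implicit Defensive.

Import Order.TTheory GRing.Theory Num.Theory.

(** * Finite simple graphs *)

Record graph := Graph {
  vertex :> finType;
  adj : rel vertex;
  adj_sym : symmetric adj;
  adj_irr : irreflexive adj
}.

Arguments adj {g}.

Definition isomorphic (G H : graph) : Prop :=
  exists2 f : G -> H, bijective f & forall x y, adj (f x) (f y) = adj x y.

(** Subgraphs need not be induced. *)
Record subgraph (U : graph) := Subgraph {
  sub_vertex : {set U};
  sub_adj : rel U;
  sub_adj_sym : symmetric sub_adj;
  sub_adjP : forall x y, sub_adj x y ->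
    [&& x \in sub_vertex, y \in sub_vertex & adj x y]
}.

Section GraphOfSubgraph.
Variables (U : graph) (S : subgraph U).

Let V := {x : U | x \in sub_vertex S}.
Let e : rel V := fun x y => sub_adj S (val x) (val y).

Fact graph_of_subgraph_sym : symmetric e.
Proof. by move=> x y; apply: sub_adj_sym. Qed.

Fact graph_of_subgraph_irr : irreflexive e.
Proof.
by move=> x; apply/negP => /sub_adjP /and3P[_ _]; rewrite adj_irr.
Qed.

Definition graph_of_subgraph : graph :=
  Graph graph_of_subgraph_sym graph_of_subgraph_irr.

End GraphOfSubgraph.

Definition contains (U H : graph) : Prop :=
  exists S : subgraph U, isomorphic (graph_of_subgraph S) H.

(** * Complete graphs, disjoint unions and joins *)

Section Complete.
Variable n : nat.

Let e : rel 'I_n := fun i j => i != j.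

Fact complete_sym : symmetric e.
Proof. by move=> i j; rewrite /e eq_sym. Qed.

Fact complete_irr : irreflexive e.
Proof. by move=> i; rewrite /e eqxx. Qed.

Definition complete : graph := Graph complete_sym complete_irr.

End Complete.

Section Sums.
Variables G H : graph.

(** [b] tells whether the vertices of [G] are adjacent to those of [H]. *)
Definition sum_adj (b : bool) : rel (G + H) := fun u v =>
  match u, v with
  | inl x, inl y => adj x y
  | inr x, inr y => adj x y
  | _, _ => b
  end.

Fact sum_adj_sym b : symmetric (sum_adj b).
Proof. by move=> [x|x] [y|y] //=; apply: adj_sym. Qed.

Fact sum_adj_irr b : irreflexive (sum_adj b).
Proof. by move=> [x|x] /=; apply: adj_irr. Qed.

Definition disjoint_union : graph :=
  Graph (sum_adj_sym false) (sum_adj_irr false).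

Definition join : graph := Graph (sum_adj_sym true) (sum_adj_irr true).

End Sums.

(** * Treewidth *)

Definition connected (G : graph) : Prop :=
  (0 < #|G|)%N /\ forall x y : G, connect adj x y.

(** In [ucycle], an edge counts as a cycle of length 2. *)
Definition acyclic (G : graph) : Prop :=
  forall c : seq G, ucycle adj c -> (size c <= 2)%N.

Definition is_tree (G : graph) : Prop := connected G /\ acyclic G.

Record tree_decomposition (G : graph) := TreeDecomposition {
  td_tree : graph;
  td_bag : td_tree -> {set G};
  td_treeP : is_tree td_tree;
  td_vertexP : forall v : G, exists t, v \in td_bag t;
  td_edgeP : forall u v : G, adj u v ->
    exists t, (u \in td_bag t) && (v \in td_bag t);
  td_connectP : forall (v : G) s t, v \in td_bag s -> v \in td_bag t ->
    connect [rel a b | [&& adj a b, v \in td_bag a & v \in td_bag b]] s t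
}.

(** Truncated subtraction: the graph without vertices gets width 0 here,
    rather than -1. *)
Definition width (G : graph) (D : tree_decomposition G) : nat :=
  (\max_(t : td_tree D) #|td_bag t|).-1.

Lemma tree_decomposition_exists (G : graph) : inhabited (tree_decomposition G).
Proof.
have one_eq (x y : complete 1) : x = y by rewrite (ord1 x) (ord1 y).
have one_tree : is_tree (complete 1).
  split; first by split=> [|x y]; [rewrite card_ord | rewrite (one_eq x y)].
  move=> [//|x [//|y c]] /andP[_]; rewrite cons_uniq => /andP[/negP[]].
  by rewrite (one_eq x y) mem_head.
constructor; apply: (@TreeDecomposition G (complete 1) (fun=> setT) one_tree).
- by move=> v; exists ord0; rewrite inE.
- by move=> u v _; exists ord0; rewrite !inE.
- by move=> v s t _ _; rewrite (one_eq s t).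
Qed.

Fact width_exists (G : graph) :
  exists n, `[< exists D : tree_decomposition G, width D = n >].
Proof.
by case: (tree_decomposition_exists G) => D; exists (width D); apply/asboolP; exists D.
Qed.

Definition treewidth (G : graph) : nat := ex_minn (width_exists G).

(** * The universal graphs *)

Local Open Scope ring_scope.

Definition alpha (w p : nat) : rat :=
  1 / (1 + (2 / 3) ^+ w)
  * ((2 + (2 / 3) ^+ w) / (1 + (2 / 3) ^+ w)) ^ (p%:Z - 1).

Definition gamma (w p : nat) : rat :=
  ((2 + (2 / 3) ^+ w) / (1 + (2 / 3) ^+ w)) ^+ p.

Definition beta (k w : nat) : rat := (2 * k + 4)%:R * (3 / 2) ^+ w.

Definition delta (k w : nat) : rat := (2 + (2 / 3) ^+ w) * beta k w.

Lemma beta_gt1 k w : 1 < beta k w.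
Proof.
have h : 1 <= (3 / 2 : rat) ^+ w by apply: exprn_ege1.
rewrite /beta; apply: (lt_le_trans (y := (2 * k + 4)%:R)).
  by rewrite ltr1n; lia.
by rewrite ler_peMr // ler0n.
Qed.

Lemma alpha_ge_beta_exists (w k : nat) : exists p, beta k w <= alpha w p.+1.
Proof.
set x : rat := (2 / 3) ^+ w.
have x0 : 0 < x by apply: exprn_gt0.
have x1 : x <= 1 by apply: exprn_ile1.
pose r := (2 + x) / (1 + x).
have r_ge : 3 / 2 <= r by rewrite /r ler_pdivlMr; lra.
have bernoulli n : 1 + n%:R / 2 <= r ^+ n.
  elim: n => [|n IH]; first by rewrite mul0r addr0 expr0.
  have n0 : 0 <= n%:R :> rat := ler0n _ n.
  rewrite exprSr -natr1; move: (n%:R : rat) (r ^+ n) n0 IH => a b a0 IH.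
  by have : b * (3 / 2) <= b * r; [rewrite ler_pM2l //; lra | lra].
pose n := Num.truncn (4 * beta k w).
exists n.+1; rewrite /alpha -/x -/r.
have -> : n.+2%:Z - 1 = n.+1%:Z by lia.
rewrite -exprnP mul1r mulrC ler_pdivlMr; last by lra.
have hn : 4 * beta k w < n.+1%:R by exact: truncnS_gt.
have beta2 : beta k w * (1 + x) <= beta k w * 2.
  by rewrite ler_pM2l ?(lt_trans ltr01 (beta_gt1 k w)) //; lra.
apply: (le_trans beta2); apply: le_trans (bernoulli n.+1).
move: (n.+1%:R : rat) (beta k w) hn => a b; lra.
Qed.

(** The value [-1] is no candidate for [p_min]. *)
Lemma alpha0_lt_beta (w k : nat) : alpha w 0 < beta k w.
Proof.
set x : rat := (2 / 3) ^+ w.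
have x0 : 0 < x by apply: exprn_gt0.
apply: le_lt_trans (beta_gt1 k w); rewrite /alpha -/x sub0r -invr_expz expr1z.
have -> : 1 / (1 + x) * ((2 + x) / (1 + x))^-1 = 1 / (2 + x).
  by field; apply/andP; split; apply: lt0r_neq0; lra.
by rewrite ler_pdivrMr; lra.
Qed.

Definition p_min (w k : nat) : nat := ex_minn (alpha_ge_beta_exists w k).

Fixpoint universal_rec (w k d : nat) : graph :=
  match d with
  | 0 => complete `|Num.ceil (delta k w)|%N
  | d'.+1 =>
      join (complete (k.+1 * w.+1))
           (disjoint_union (universal_rec w k d') (universal_rec w k d'))
  end.

(** [G^k_{w,p}]; only meaningful for [p_min w k <= p]. *)
Definition universal (w k p : nat) : graph := universal_rec w k (p - p_min w k).

(* Main.v *)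
Require Import Defs.
From mathcomp Require Import all_boot all_order all_algebra.
From mathcomp Require Import boolp archimedean.
From mathcomp Require Import ring lra zify.

Import Order.TTheory GRing.Theory Num.Theory.

Local Open Scope ring_scope.

(** A set [S] of vertices is embedded by induction on [p]. With [x = (2/3)^w] and
    [a = alpha w p], one has [gamma w p = (2 + x) a] and [gamma w (p - 1) = (1 + x) a], so
    it suffices to remove [(k + 1)(w + 1)] vertices from [S] in such a way that the rest
    splits into two nonadjacent sides of at most [(1 + x) a] vertices each.

    Start with all of [S] on one side and improve the balance [w + 1] times. Each time, a
    single bag is removed and a prescribed number of vertices, up to a factor 2, moves from
    the larger side to the other one. The bag is found at the far end of a minimal branch
    of the decomposition tree that still carries more than [M] vertices of the larger
    side: all further branches at this bag carry at most [M], and some union of them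
    carries between [M / 2] and [M]. Losing the bag is harmless as [a >= beta k w]. *)

(** * Containment and partial embeddings *)

Lemma contains_of_embedding (U H : graph) (f : H -> U) :
  injective f -> (forall x y, adj x y -> adj (f x) (f y)) -> contains U H.
Proof.
move=> f_inj f_adj.
(* Only images of edges of [H] are kept, not the induced subgraph, so that [f] becomes an
   isomorphism onto its image. *)
pose e (u v : U) := [exists x, exists y, [&& f x == u, f y == v & adj x y]].
have e_f x y : e (f x) (f y) = adj x y.
  apply/existsP/idP => [[x' /existsP[y' /and3P[/eqP/f_inj-> /eqP/f_inj->]]] //|xy].
  by exists x; apply/existsP; exists y; rewrite !eqxx.
have e_sym : symmetric e.
  suff e_imp u v : e u v -> e v u by move=> u v; apply/idP/idP; apply: e_imp.
  move=> /existsP[x /existsP[y /and3P[/eqP<- /eqP<- xy]]].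
  by rewrite e_f adj_sym.
have eP u v : e u v ->
    [&& u \in [set z in codom f], v \in [set z in codom f] & adj u v].
  move=> /existsP[x /existsP[y /and3P[/eqP<- /eqP<- xy]]].
  by rewrite !inE !codom_f f_adj.
pose S := Subgraph e_sym eP; exists S.
have cod (u : graph_of_subgraph S) : val u \in codom f by move: (valP u); rewrite inE.
have mem_f x : f x \in sub_vertex S by rewrite inE codom_f.
exists (fun u => iinv (cod u)).
  exists (fun x => exist _ (f x) (mem_f x)) => [u|x].
    by apply: val_inj; rewrite /= f_iinv.
  by apply: f_inj; rewrite f_iinv.
by move=> u v; rewrite -e_f !f_iinv.
Qed.

(** The map is total but constrained on [S] only. The induction can thus run over vertex sets of one
    graph with one fixed decomposition, instead of over induced subgraphs. *)
Definition embeds (H U : graph) (S : {set H}) : Prop :=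
  exists f : H -> U, {in S &, injective f} /\
    {in S &, forall x y, adj x y -> adj (f x) (f y)}.

Definition nonadjacent (H : graph) (A B : {set H}) : Prop :=
  forall x y, x \in A -> y \in B -> ~~ adj x y.

Lemma embeds_complete (H : graph) (S : {set H}) (n : nat) :
  (0 < n)%N -> (#|S| <= n)%N -> embeds H (complete n) S.
Proof.
case: n => // n _ Sn.
pose f x : complete n.+1 := inord (index x (enum S)).
have f_inj : {in S &, injective f}.
  have lt_index x : x \in S -> (index x (enum S) < n.+1)%N.
    by move=> xS; apply: leq_trans Sn; rewrite cardE index_mem mem_enum.
  move=> x y xS yS /(congr1 val); rewrite /= !inordK ?lt_index // => eq_xy.
  have xE : x \in enum S by rewrite mem_enum.
  have yE : y \in enum S by rewrite mem_enum.
  by rewrite -(nth_index x xE) eq_xy nth_index.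
exists f; split=> // x y xS yS xy; apply/eqP => /(f_inj _ _ xS yS) eq_xy.
by rewrite eq_xy adj_irr in xy.
Qed.

Lemma embeds_join (H K U1 U2 : graph) (S A B : {set H}) :
  nonadjacent H A B -> embeds H K (S :\: (A :|: B)) ->
  embeds H U1 A -> embeds H U2 B -> embeds H (join K (disjoint_union U1 U2)) S.
Proof.
move=> nAB [g [g_inj g_adj]] [f1 [f1_inj f1_adj]] [f2 [f2_inj f2_adj]].
pose f x : join K (disjoint_union U1 U2) :=
  if x \in A then inr (inl (f1 x)) else if x \in B then inr (inr (f2 x)) else inl (g x).
have outside x : x \in S -> x \notin A -> x \notin B -> x \in S :\: (A :|: B).
  by move=> xS xA xB; rewrite !inE negb_or xA xB.
exists f; split=> x y xS yS; rewrite /f;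
  case: (boolP (x \in A)) => xA; case: (boolP (y \in A)) => yA;
  case: (boolP (x \in B)) => xB; case: (boolP (y \in B)) => yB //=.
all: try by case; first [exact: f1_inj | exact: f2_inj | apply: g_inj; exact: outside].
all: try first [exact: f1_adj | exact: f2_adj | apply: g_adj; exact: outside].
all: try by rewrite (negbTE (nAB x y _ _)).
all: by rewrite adj_sym (negbTE (nAB y x _ _)).
Qed.

(** * Unions of small classes *)

(** Take a largest closed [A] with at most [M] elements. If it had fewer than [M / 2], the class [C]
    of a point outside [A] would have at most as many elements as [A] by maximality, and [A :|: C]
    would be a larger candidate. *)
Lemma exists_closed_subset (T : finType) (e : rel T) (D : {set T}) (M : rat) :
  equivalence_rel e ->
  (forall v, v \in D -> #|[set u in D | e v u]|%:R <= M) ->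
  0 <= M -> M / 2 <= #|D|%:R ->
  exists A : {set T}, [/\ A \subset D,
    forall u v, u \in A -> v \in D -> e u v -> v \in A,
    M / 2 <= #|A|%:R & #|A|%:R <= M].
Proof.
move=> e_equiv class_le M_ge0 D_ge.
have e_refl x : e x x by rewrite (e_equiv x x x).1.
have e_trans x y z : e x y -> e y z -> e x z.
  by move=> xy yz; rewrite ((e_equiv x y z).2 xy).
pose closed (A : {set T}) := [&& A \subset D,
  [forall u in A, [forall v in D, e u v ==> (v \in A)]] & (#|A|%:R <= M :> rat)].
have closedP A : closed A -> [/\ A \subset D,
    forall u v, u \in A -> v \in D -> e u v -> v \in A & #|A|%:R <= M].
  case/and3P=> AD /forall_inP cl AM; split=> // u v uA vD.
  by move/forall_inP: (cl u uA) => /(_ v vD) /implyP.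
have closedI (A : {set T}) : A \subset D ->
    (forall u v, u \in A -> v \in D -> e u v -> v \in A) -> #|A|%:R <= M -> closed A.
  move=> AD cl AM; apply/and3P; split=> //; apply/forall_inP => u uA.
  by apply/forall_inP => v vD; apply/implyP; apply: cl.
have closed0 : closed set0.
  by apply: closedI; rewrite ?sub0set ?cards0 // => u v; rewrite inE.
case: (@arg_maxnP _ set0 closed (fun A => #|A|) closed0) => A /closedP[AD A_cl AM] A_max.
exists A; split=> //; rewrite leNgt; apply/negP => A_lt.
have [v vD vA] : exists2 v, v \in D & v \notin A.
  apply/subsetPn; apply/negP => DA; move: D_ge A_lt (subset_leq_card DA).
  by rewrite -(ler_nat rat) => *; lra.
pose C := [set u in D | e v u].
have CD : C \subset D by apply/subsetP => u; rewrite inE => /andP[].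
have C_cl x y : x \in C -> y \in D -> e x y -> y \in C.
  by rewrite !inE => /andP[_ vx] -> /(e_trans _ _ _ vx).
have vC : v \in C by rewrite inE vD e_refl.
have C_le : (#|C| <= #|A|)%N by apply/A_max/closedI => //; apply: class_le.
have AC_cl : closed (A :|: C).
  apply: closedI => [|x y|]; first by rewrite subUset AD.
    rewrite !(inE, in_setU) => /orP[xA yD xy|xC yD xy].
      by rewrite (A_cl x y).
    by move: (C_cl x y); rewrite !inE xC yD xy /= => -> //; rewrite orbT.
  have: (#|A :|: C| <= #|A| + #|A|)%N.
    by apply: leq_trans (leq_card_setU _ _) _; rewrite leq_add2l.
  by rewrite -(ler_nat rat) natrD => *; lra.
have /proper_card : A \proper A :|: C.
  by apply/properP; split; [exact: subsetUl | exists v; rewrite // in_setU vC orbT].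
by rewrite ltnNge (A_max _ AC_cl : (_ <= _)%N).
Qed.

(** * Branches of a tree at a node *)

Definition off_adj (T : graph) (t : T) : rel T :=
  [rel a b | [&& adj a b, a != t & b != t]].

(** The classes are the branches at [t], together with [t] alone. *)
Definition off (T : graph) (t : T) : rel T := connect (off_adj T t).

Lemma off_sym (T : graph) (t a b : T) : off T t a b = off T t b a.
Proof.
by apply: sym_connect_sym => x y; rewrite /off_adj /= adj_sym; case: (x == t); case: (y == t).
Qed.

Lemma off_trans (T : graph) (t : T) : transitive (off T t).
Proof. exact: connect_trans. Qed.

Lemma off_neq (T : graph) (t a b : T) : off T t a b -> a != t -> b != t.
Proof.
move=> /connectP[p pth ->]; elim: p a pth => //= x p IH a /andP[/and3P[_ _ xt] pth] _.
exact: IH.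
Qed.

Lemma exists_neighbor_off (T : graph) (t c : T) :
  connected T -> c != t -> exists2 t', adj t t' & off T t c t'.
Proof.
move=> [_ /(_ t c)] /connectP[p0 + ->]; case/shortenP => -[|t' p] /=; first by rewrite eqxx.
move=> /andP[tt' pth] /and3P[+ _ _] _ _; rewrite inE negb_or => /andP[t't tp].
exists t' => //; rewrite off_sym; apply/connectP; exists p => //.
elim: p t' {tt'} pth t't tp => //= x p IH a /andP[ax pth] ta.
rewrite inE negb_or => /andP[tx tp].
by apply/andP; split; [apply/and3P; rewrite ax eq_sym ta eq_sym tx | exact: IH].
Qed.

(** A simple path from [a] to [b] that avoids [t] would close up through [t] to a cycle of length at
    least 3. *)
Lemma neighbor_off_unique (T : graph) (t a b : T) :
  acyclic T -> adj t a -> adj t b -> off T t a b -> a = b.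
Proof.
move=> T_acyclic ta tb /connectP[p0 pth0 b_eq]; move: tb; rewrite {}b_eq.
case/shortenP: pth0 => -[//|x p] pth a_uniq _ tb; exfalso.
have adj_neq y z : @adj T y z -> z != y.
  by move=> yz; apply: contraTneq yz => ->; rewrite adj_irr.
have off_path y q : y != t -> path (off_adj T t) y q -> path adj y q && (t \notin y :: q).
  elim: q y => [|z q IH] y yt /=; first by rewrite inE eq_sym.
  move=> /andP[/and3P[-> _ zt] /(IH _ zt)/andP[-> tq]].
  by rewrite inE negb_or eq_sym yt.
have /andP[adj_p t_notin] := off_path _ _ (adj_neq _ _ ta) pth.
have /T_acyclic // : ucycle adj [:: t, a, x & p].
apply/andP; split; last by rewrite cons_uniq t_notin.
by rewrite /cycle rcons_path; apply/andP; split; [rewrite /= ta | rewrite adj_sym].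
Qed.

(** The branch at [t] can only be left through [t], and [t'] is the only node of it adjacent to [t];
    a walk avoiding [t'] therefore stays inside. *)
Lemma off_branch_subset (T : graph) (t t' c c' x : T) :
  acyclic T -> adj t t' -> off T t c t' -> off T t c c' -> c' != t' ->
  off T t' c' x -> off T t c x.
Proof.
move=> T_acyclic tt' ct' + + /connectP[p + ->].
have t't : t' != t by apply: contraTneq tt' => ->; rewrite adj_irr.
elim: p c' => //= z p IH y cy yt' /andP[/and3P[yz _ zt'] pth].
apply: IH pth => //; apply: (off_trans _ _ _ _ _ cy).
have yt : y != t by apply: off_neq t't; apply: off_trans cy; rewrite off_sym.
apply: connect1; rewrite /off_adj /= yz yt; apply: contraNneq yt' => zt.
rewrite zt in yz; rewrite eq_sym; apply/eqP; apply: (neighbor_off_unique _ _ _ _ T_acyclic tt').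
  by rewrite adj_sym.
by apply: off_trans cy; rewrite off_sym.
Qed.

(** * Separators from bags *)

Lemma bag_off (H : graph) (D : tree_decomposition H) (v : H) (t a b : td_tree D) :
  v \notin td_bag t -> v \in td_bag a -> v \in td_bag b -> off _ t a b.
Proof.
move=> vt va vb; move: (td_connectP va vb); apply: connect_sub => x y /=.
move=> /and3P[xy vx vy]; apply: connect1; rewrite /off_adj /= xy.
by rewrite !(contraNneq _ vt) // => <-.
Qed.

Lemma exists_separator (H : graph) (D : tree_decomposition H) (k : nat)
    (S : {set H}) (M : rat) :
  (forall t, (#|@td_bag _ D t| <= k.+1)%N) -> 2 * k.+1%:R <= M -> M < #|S|%:R ->
  exists X A : {set H}, [/\ (#|X| <= k.+1)%N, A \subset S :\: X,
    nonadjacent H A (S :\: X :\: A), M / 2 <= #|A|%:R & #|A|%:R <= M].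
Proof.
move=> bag_le M_ge S_gt.
have [T_conn T_acyclic] := td_treeP D.
(* Any choice of node will do: outside the bag at [t], all nodes whose bags contain [v] lie in the
   same branch at [t]. *)
pose node v := xchoose (td_vertexP D v).
have nodeP v : v \in td_bag (node v) by apply: (xchooseP (td_vertexP D v)).
pose near t : rel H := fun u v => off (td_tree D) t (node u) (node v).
have near_equiv t : equivalence_rel (near t).
  apply/equivalence_relP; split=> [v|u v uv w]; first exact: connect0.
  by apply/idP/idP; apply: off_trans => //; rewrite off_sym.
have adj_near t u v : u \notin td_bag t -> v \notin td_bag t -> adj u v -> near t u v.
  move=> ut vt /(td_edgeP D)[s /andP[us vs]].
  apply: off_trans (bag_off _ _ _ _ _ _ ut (nodeP u) us) _.
  exact: bag_off vt vs (nodeP v).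
pose weight t c := #|[set v in S :\: td_bag t | off _ t c (node v)]|.
have cut_at t (E : {set H}) : E \subset S :\: td_bag t ->
    (forall u v, u \in E -> v \in S :\: td_bag t -> near t u v -> v \in E) ->
    (forall v, v \in E -> (weight t (node v))%:R <= M) -> M / 2 <= #|E|%:R ->
  exists X A : {set H}, [/\ (#|X| <= k.+1)%N, A \subset S :\: X,
    nonadjacent H A (S :\: X :\: A), M / 2 <= #|A|%:R & #|A|%:R <= M].
  move=> ES E_cl E_weight E_ge.
  have class_le v : v \in E -> #|[set u in E | near t v u]|%:R <= M.
    move=> vE; apply: le_trans (E_weight v vE); rewrite ler_nat subset_leq_card //.
    by apply/subsetP => u; rewrite inE => /andP[/(subsetP ES) uS vu]; rewrite inE uS.
  have M_ge0 : 0 <= M by apply: le_trans M_ge; rewrite mulr_ge0.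
  have [A [AE A_cl A_ge A_le]] :=
    exists_closed_subset _ _ _ _ (near_equiv t) class_le M_ge0 E_ge.
  exists (td_bag t), A; split=> //; first exact: subset_trans ES.
  move=> u v uA; rewrite in_setD => /andP[vA vS]; apply: contra vA => uv.
  have uE := subsetP AE u uA.
  have uv_near : near t u v.
    by move: (subsetP ES u uE) vS; rewrite !inE => /andP[ut _] /andP[vt _]; apply: adj_near.
  exact: (A_cl u v uA (E_cl u v uE vS uv_near) uv_near).
(* Losing a bag costs at most [k.+1], which is at most [M / 2]. *)
have half_le (E W : {set H}) (t : td_tree D) :
    M < #|W|%:R -> W \subset E :|: td_bag t -> M / 2 <= #|E|%:R.
  move=> W_gt WE.
  have : (#|W| <= #|E| + k.+1)%N.
    apply: leq_trans (subset_leq_card WE) _; apply: leq_trans (leq_card_setU _ _) _.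
    by rewrite leq_add2l.
  rewrite -(ler_nat rat) natrD => *; lra.
pose heavy (tc : td_tree D * td_tree D) := (tc.2 != tc.1) && (M < (weight tc.1 tc.2)%:R).
have [[tc0 tc0_heavy]|light] := pselect (exists tc, heavy tc); last first.
  (* Without heavy branches, every node is a suitable place to cut. *)
  have /card_gt0P[r _] := T_conn.1.
  apply: (cut_at r (S :\: td_bag r)) => [//|//|v|].
    rewrite inE => /andP[vr _]; rewrite leNgt; apply/negP => v_heavy.
    apply: light; exists (r, node v); rewrite /heavy v_heavy andbT /=.
    by apply: contraNneq vr => <-.
  by apply: (half_le _ _ r S_gt); apply/subsetP => v; rewrite !inE => ->;
    case: (v \in td_bag r).
(* The cut is made at [t'], the first node of a minimal heavy branch at [t]. A branch at [t']
   meeting the node of a vertex of [E] lies inside that heavy branch and misses [t'], so it is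
   strictly smaller and cannot be heavy. *)
case: (arg_minnP (fun tc => #|[set x | off _ tc.1 tc.2 x]|) tc0_heavy) => -[t c].
rewrite /heavy /= => /andP[ct tc_heavy] tc_min.
have [t' tt' ct'] := exists_neighbor_off _ _ _ T_conn ct.
pose E := [set v in S :\: td_bag t' | off _ t c (node v)].
apply: (cut_at t' E).
- by apply/subsetP => v; rewrite inE => /andP[].
- move=> u v; rewrite inE => /andP[uS cu] vS uv; rewrite inE vS /=.
  apply: off_branch_subset T_acyclic tt' ct' cu _ uv.
  by apply: contraTneq uS => <-; rewrite inE nodeP.
- move=> v; rewrite !inE => /andP[/andP[vt' _] cv]; rewrite leNgt; apply/negP => v_heavy.
  have vt'_neq : node v != t' by apply: contraNneq vt' => <-.
  have /tc_min : heavy (t', node v) by rewrite /heavy /= vt'_neq.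
  rewrite /= leqNgt => /negP; apply; apply: proper_card; apply/properP; split.
    by apply/subsetP => x; rewrite !inE; apply: off_branch_subset T_acyclic tt' ct' cv _.
  by exists t'; rewrite inE //; apply/negP => /off_neq /(_ vt'_neq); rewrite eqxx.
apply: (half_le _ _ t' tc_heavy); apply/subsetP => v; rewrite !inE => /andP[/andP[_ ->] ->].
by case: (v \in td_bag t').
Qed.

Lemma treewidth_bag_le (H : graph) (k : nat) : (treewidth H <= k)%N ->
  exists D : tree_decomposition H, forall t : td_tree D, (#|td_bag t| <= k.+1)%N.
Proof.
rewrite /treewidth; case: ex_minnP => m /asboolP[D Dm] _ mk; exists D => t.
have : (#|td_bag t| <= \max_(t : td_tree D) #|td_bag t|)%N by exact: leq_bigmax_cond.
by move: Dm; rewrite /width; case: (\max_t _)%N => [|n] /=; lia.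
Qed.

(** * Balanced separations *)

Definition separates (H : graph) (S : {set H}) (s : nat) (A B : {set H}) : Prop :=
  [/\ A \subset S, B \subset S, [disjoint A & B], nonadjacent H A B
    & (#|S :\: (A :|: B)| <= s)%N].

Definition has_separation (H : graph) (S : {set H}) (s : nat) (c : rat) : Prop :=
  exists A B, separates H S s A B /\ (#|A|%:R <= c /\ #|B|%:R <= c).

Lemma separates_sym (H : graph) (S : {set H}) (s : nat) (A B : {set H}) :
  separates H S s A B -> separates H S s B A.
Proof.
move=> [AS BS dAB nAB s_ge]; split; rewrite 1?disjoint_sym 1?setUC //.
by move=> x y xB yA; rewrite adj_sym nAB.
Qed.

(** Between [M / 2] and [M] vertices move from [A] to [B]. *)
Lemma separation_refine (H : graph) (D : tree_decomposition H) (k s : nat)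
    (S A B : {set H}) (c M : rat) :
  (forall t, (#|@td_bag _ D t| <= k.+1)%N) -> 2 * k.+1%:R <= M ->
  separates H S s A B -> M < #|A|%:R -> #|A|%:R - M / 2 <= c -> #|B|%:R + M <= c ->
  has_separation H S (s + k.+1) c.
Proof.
move=> bag_le M_ge [AS BS dAB nAB s_ge] M_lt Ac Bc.
have [X [A1 [X_le A1_sub nA1 A1_ge A1_le]]] :=
  exists_separator _ _ _ _ _ bag_le M_ge M_lt.
have A1A : A1 \subset A := subset_trans A1_sub (subsetDl _ _).
have A'A : A :\: X :\: A1 \subset A by rewrite setDDl subsetDl.
exists (A :\: X :\: A1), (B :|: A1); split; [split|split].
- exact: subset_trans AS.
- by rewrite subUset BS (subset_trans A1A).
- rewrite -setI_eq0; apply/eqP/setP => x; rewrite !inE.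
  have := disjointFr dAB (x := x); case: (x \in A1) => //=; case: (x \in A) => [->|] //=;
    by rewrite ?andbF ?orbF.
- move=> x y xA'; rewrite inE => /orP[yB|yA1]; first by apply: nAB => //; apply: (subsetP A'A).
  by rewrite adj_sym nA1.
- apply: (@leq_trans #|(S :\: (A :|: B)) :|: X|).
    apply: subset_leq_card; apply/subsetP => x; rewrite !inE.
    by case: (x \in X); case: (x \in A1); case: (x \in A); case: (x \in B); case: (x \in S).
  by apply: leq_trans (leq_card_setU _ _) _; apply: leq_add.
- have : (#|A :\: X :\: A1| + #|A1| <= #|A|)%N.
    by rewrite -(cardsID A1 A) (setIidPr A1A) addnC leq_add2l
      subset_leq_card // setSD ?subsetDl.
  by rewrite -(ler_nat rat) natrD => *; lra.
have : (#|B :|: A1| <= #|B| + #|A1|)%N by exact: leq_card_setU.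
by rewrite -(ler_nat rat) natrD => *; lra.
Qed.

(* The side exceeding [(1 + (2/3)^(j+1)) a] gives away between [(2/3)^j a / 3]
   and twice as many vertices; the other side stays below the new bound since
   it had at most [(1 + (2/3)^w - (2/3)^(j+1)) a] vertices. *)
Lemma has_balanced_separation (H : graph) (D : tree_decomposition H) (k w : nat)
    (S : {set H}) (a : rat) :
  (forall t, (#|@td_bag _ D t| <= k.+1)%N) -> 2 * k.+1%:R <= (2 / 3) ^+ w * a ->
  #|S|%:R <= (2 + (2 / 3) ^+ w) * a ->
  forall j, (j <= w)%N -> has_separation H S (k.+1 * j.+1) ((1 + (2 / 3) ^+ j) * a).
Proof.
move=> bag_le; set x := (2 / 3) ^+ w => xa_ge S_le.
have x_gt0 : 0 < x by apply: exprn_gt0.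
have a_ge0 : 0 <= a by rewrite -(pmulr_rge0 _ x_gt0); apply: le_trans xa_ge; rewrite mulr_ge0.
have x_le j : (j <= w)%N -> x * a <= (2 / 3) ^+ j * a.
  by move=> jw; rewrite ler_wpM2r // ler_wiXn2l.
elim=> [_|j IH jw].
  have := x_le 0 (leq0n w); rewrite expr0 muln1 => xa_le.
  have sepS : separates H S 0 S set0.
    by split; rewrite ?sub0set ?setU0 ?setDv ?cards0 -?setI_eq0 ?setI0 ?eqxx //
      => y z _; rewrite inE.
  (* The first of the [w.+1] improvements aims at the bound [2 * a]. With [M = 2 * a], the large
     side keeps at most [(1 + x) * a], and [x <= 1]. *)
  have [S_le2|S_gt2] := leP (#|S|%:R : rat) (2 * a).
    exists S, set0; rewrite cards0; split; last by split; lra.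
    by case: sepS => *; split=> //; exact: leq_trans (leq0n _).
  by apply: (separation_refine _ _ _ _ _ _ _ _ (2 * a) bag_le _ sepS);
    rewrite ?cards0; lra.
have [A [B [+ [+ +]]]] := IH (ltnW jw).
wlog BA : A B / (#|B| <= #|A|)%N.
  move=> wlogA sep A_le B_le; have [/wlogA|/ltnW/wlogA] := leqP #|B| #|A|; first exact.
  by apply=> //; exact: separates_sym.
move=> sep A_le B_le; have := x_le j.+1 jw; move: A_le B_le; rewrite exprS.
set y := (2 / 3) ^+ j => A_le B_le xy.
rewrite [(k.+1 * _)%N]mulnS addnC.
have [A_le'|A_gt] := leP (#|A|%:R : rat) ((1 + 2 / 3 * y) * a).
  exists A, B; split.
    by case: sep => *; split=> //; apply: leq_trans (leq_addr _ _).
  by split=> //; apply: le_trans A_le'; rewrite ler_nat.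
have AB_card : #|A|%:R + #|B|%:R <= #|S|%:R :> rat.
  case: sep => AS BS dAB _ _; rewrite -natrD ler_nat -cardsUI disjoint_setI0 // cards0 addn0.
  by rewrite subset_leq_card // subUset AS.
by apply: (separation_refine _ _ _ _ _ _ _ _ (2 / 3 * y * a) bag_le _ sep); lra.
Qed.

(** * Numerical bounds *)

Lemma gammaE (w p : nat) : gamma w p = (2 + (2 / 3) ^+ w) * alpha w p.
Proof.
have x_gt0 : 0 < (2 / 3 : rat) ^+ w by apply: exprn_gt0.
rewrite /gamma /alpha; set x := (2 / 3) ^+ w in x_gt0 *.
rewrite expfzDr; last by apply: lt0r_neq0; rewrite divr_gt0 //; lra.
rewrite -exprnP -invr_expz expr1z; field.
by apply/andP; split; apply: lt0r_neq0; lra.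
Qed.

Lemma gamma_alphaS (w p : nat) : gamma w p = (1 + (2 / 3) ^+ w) * alpha w p.+1.
Proof.
have x_gt0 : 0 < (2 / 3 : rat) ^+ w by apply: exprn_gt0.
rewrite /alpha; have -> : p.+1%:Z - 1 = p%:Z by lia.
rewrite -exprnP -/(gamma w p); field; apply: lt0r_neq0; lra.
Qed.

Lemma gamma_le (w p q : nat) : (p <= q)%N -> gamma w p <= gamma w q.
Proof.
have x_gt0 : 0 < (2 / 3 : rat) ^+ w by apply: exprn_gt0.
by move=> pq; apply: ler_weXn2l => //; rewrite ler_pdivlMr; lra.
Qed.

Lemma beta_le_alpha (w k p : nat) : (p_min w k < p)%N -> beta k w <= alpha w p.
Proof.
case: p => // p; rewrite ltnS => p_ge.
have x_gt0 : 0 < (2 / 3 : rat) ^+ w by apply: exprn_gt0.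
apply: (@le_trans _ _ (alpha w (p_min w k).+1)); first by rewrite /p_min; case: ex_minnP.
(* Monotonicity of [alpha] is read off from that of [gamma]. *)
by rewrite -(@ler_pM2l _ (1 + (2 / 3) ^+ w)) -?gamma_alphaS ?gamma_le //; lra.
Qed.

Lemma alpha_p_min_lt (w k : nat) : alpha w (p_min w k) < beta k w.
Proof.
rewrite /p_min; case: ex_minnP => -[|m] _ m_min; first exact: alpha0_lt_beta.
by rewrite ltNge; apply/negP => /m_min; rewrite ltnn.
Qed.

(** This makes the clique at the bottom of the recursion large enough. *)
Lemma gamma_p_min_le (w k : nat) : gamma w (p_min w k) <= `|Num.ceil (delta k w)|%N%:R.
Proof.
have x_gt0 : 0 < (2 / 3 : rat) ^+ w by apply: exprn_gt0.
apply: (@le_trans _ _ (delta k w)).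
  by rewrite gammaE /delta ler_pM2l ?ltW ?alpha_p_min_lt //; lra.
apply: le_trans (ceil_ge _) _; by rewrite pmulrn ler_int abszE ler_norm.
Qed.

(** * The induction on the depth *)

Lemma universal_rec_embeds (w k d : nat) (H : graph)
    (D : tree_decomposition H) (S : {set H}) :
  (forall t, (#|@td_bag _ D t| <= k.+1)%N) ->
  #|S|%:R <= gamma w (p_min w k + d) -> embeds H (universal_rec w k d) S.
Proof.
move=> bag_le; elim: d S => [|d IH] S S_le.
  rewrite addn0 in S_le; have S_ceil := le_trans S_le (gamma_p_min_le w k).
  apply: embeds_complete; last by rewrite -(ler_nat rat).
  (* [S] may be empty, but a total map still needs a nonempty target; [1 <= gamma] provides it. *)
  rewrite -(ltr_nat rat); apply: lt_le_trans (gamma_p_min_le w k).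
  by apply: lt_le_trans (gamma_le w 0 _ (leq0n _)); rewrite /gamma expr0.
rewrite addnS gammaE in S_le.
have alpha_ge : 2 * k.+1%:R <= (2 / 3) ^+ w * alpha w (p_min w k + d).+1.
  have beta_le : beta k w <= alpha w (p_min w k + d).+1.
    by apply: beta_le_alpha; rewrite ltnS leq_addr.
  (* The factor [(3 / 2) ^+ w] of [beta] cancels [(2 / 3) ^+ w], leaving [2 * k + 4]. *)
  apply: (@le_trans _ _ ((2 / 3) ^+ w * beta k w)); last by rewrite ler_pM2l ?exprn_gt0.
  rewrite /beta mulrCA -exprMn (_ : 2 / 3 * (3 / 2) = 1 :> rat) ?expr1n ?mulr1 //.
  by rewrite -natrM ler_nat; lia.
(* At [j = w] the bound on each side is exactly [gamma] one level down, and the leftover fits into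
   the joined clique. *)
have [A [B [[AS BS _ nAB s_ge] [A_le B_le]]]] :=
  has_balanced_separation _ _ _ _ _ _ bag_le alpha_ge S_le w (leqnn w).
apply: embeds_join nAB _ (IH A _) (IH B _); rewrite ?gamma_alphaS //.
by apply: embeds_complete s_ge; rewrite muln_gt0.
Qed.

Theorem theorem4p10 (w k p : nat) (hk : (1 <= k)%N) (hp : (p_min w k <= p)%N)
  (H : graph) (hcard : #|H|%:R <= gamma w p) (htw : (treewidth H <= k)%N) :
  contains (universal w k p) H.
Proof.
have [D bag_le] := treewidth_bag_le _ _ htw.
have [|f [f_inj f_adj]] := universal_rec_embeds w k (p - p_min w k) H D [set: H] bag_le.
  by rewrite subnKC // cardsT.
apply: (contains_of_embedding _ _ f) => x y; first by apply: f_inj; rewrite inE.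
by apply: f_adj; rewrite inE.
Qed.
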